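(* Let $H$ be a finite index subgroup of the group $G=\langle X\mid R\rangle$, where $X$ is finite and $R$ is not necessarily finite. Then $H$ is normal in $G$ if and only if the based $X$-graphs $(\Gamma_{X,R}(H),1_H)$ and $(\Gamma_{X,R}(H),v)$ are isomorphic for all vertices $v\in V(\Gamma_{X,R}(H))$.
   Context: An $X$-graph is a directed graph (loops and multiple edges allowed) in which every directed edge carries a label from $X$. A morphism of $X$-graphs maps vertices to vertices and directed edges to directed edges, preserving labels, origins and termini; a morphism of based $X$-graphs $(\Gamma,v)\to(\Gamma',v')$ also maps $v$ to $v'$. An isomorphism is an invertible morphism. For a finite index subgroup $H$ of $G=\langle X\mid R\rangle$, the subgroup graph $\Gamma_{X,R}(H)$ is the Schreier coset graph of $H$ with respect to $X$ and $G$: its vertices are the right cosets $Hg$ ($g\in G$), and for each coset $Hg$ and each $x\in X$ there is one directed edge labeled $x$ with origin $Hg$ and terminus $Hgx$. Its base-vertex $1_H$ is the coset $H$. *)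

(* Defs.v *)
From HB Require Import structures.
From mathcomp Require Import all_boot generic_quotient.
From mathcomp Require Import boolp classical_sets functions cardinality.

Set Implicit Arguments.
Unset Strict Implicit.
Unset Printing Implicit Defensive.

Local Open Scope classical_set_scope.
Local Open Scope quotient_scope.
Local Open Scope group_scope.

(** * Group presentations *)

(* The letter (x, b) stands for x if b = false and for x^-1 if b = true. *)
Definition word (X : Type) := seq (X * bool).

Definition word_inv X (w : word X) : word X :=
  rev [seq (a.1, ~~ a.2) | a <- w].

(* The congruence of the presentation < X | R >: a relator, or a letter followed
   by its inverse, may be inserted or deleted anywhere. *)
Inductive pres_eq (X : Type) (R : set (word X)) : word X -> word X -> Prop :=
| pres_refl w : pres_eq R w w
| pres_sym w1 w2 : pres_eq R w1 w2 -> pres_eq R w2 w1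
| pres_trans w2 w1 w3 : pres_eq R w1 w2 -> pres_eq R w2 w3 -> pres_eq R w1 w3
| pres_cancel u x b v : pres_eq R (u ++ (x, b) :: (x, ~~ b) :: v) (u ++ v)
| pres_relator u r v : R r -> pres_eq R (u ++ r ++ v) (u ++ v).

Section PresCongruence.
Context (X : Type) (R : set (word X)).
Implicit Types u v w : word X.

Lemma pres_eq_cat2l u v w : pres_eq R v w -> pres_eq R (u ++ v) (u ++ w).
Proof.
elim=> {v w} [w|w1 w2 _|w2 w1 w3 _ + _|v x b w|v r w Rr].
- exact: pres_refl.
- exact: pres_sym.
- exact: pres_trans.
- by rewrite !catA; apply: pres_cancel.
- by rewrite !(catA u v); apply: pres_relator.
Qed.

Lemma pres_eq_cat2r u v w : pres_eq R v w -> pres_eq R (v ++ u) (w ++ u).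
Proof.
elim=> {v w} [w|w1 w2 _|w2 w1 w3 _ + _|v x b w|v r w Rr].
- exact: pres_refl.
- exact: pres_sym.
- exact: pres_trans.
- by rewrite -!catA; apply: pres_cancel.
- by rewrite -!catA; apply: pres_relator.
Qed.

Lemma pres_eq_cat u u' v v' :
  pres_eq R u u' -> pres_eq R v v' -> pres_eq R (u ++ v) (u' ++ v').
Proof.
move=> uu' vv'; apply: (@pres_trans _ _ (u' ++ v)).
- exact: pres_eq_cat2r.
- exact: pres_eq_cat2l.
Qed.

Lemma word_invK : involutive (@word_inv X).
Proof.
move=> w; rewrite /word_inv map_rev revK -map_comp -[RHS]map_id.
by apply: eq_map => -[x b] /=; rewrite negbK.
Qed.

Lemma pres_mulwV w : pres_eq R (w ++ word_inv w) [::].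
Proof.
elim: w => [|[x b] w IHw]; first exact: pres_refl.
rewrite /word_inv /= rev_cons -cats1 catA.
apply: (@pres_trans _ _ ([:: (x, b)] ++ [::] ++ [:: (x, ~~ b)])).
  exact: pres_eq_cat2r (pres_eq_cat2l [:: (x, b)] IHw).
exact: (@pres_cancel _ R [::] x b [::]).
Qed.

Lemma pres_mulVw w : pres_eq R (word_inv w ++ w) [::].
Proof. by rewrite -{2}[w]word_invK; apply: pres_mulwV. Qed.

Lemma pres_eq_inv v w : pres_eq R v w -> pres_eq R (word_inv v) (word_inv w).
Proof.
move=> vw; apply: (@pres_trans _ _ (word_inv v ++ (w ++ word_inv w))).
  rewrite -[X in pres_eq _ X]cats0.
  by apply/pres_eq_cat2l/pres_sym/pres_mulwV.
rewrite catA -[X in pres_eq _ _ X]cat0s; apply: pres_eq_cat2r.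
apply: (@pres_trans _ _ (word_inv v ++ v)); last exact: pres_mulVw.
exact/pres_eq_cat2l/pres_sym.
Qed.

End PresCongruence.

Section PresentedGroup.
Context (X : choiceType) (R : set (word X)).

Definition pres_rel : rel (word X) := fun v w => `[< pres_eq R v w >].

Fact pres_rel_refl : reflexive pres_rel.
Proof. by move=> w; apply/asboolP/pres_refl. Qed.

Fact pres_rel_sym : symmetric pres_rel.
Proof. by move=> v w; apply/asbool_equiv_eq; split; apply: pres_sym. Qed.

Fact pres_rel_trans : transitive pres_rel.
Proof.
by move=> w v u /asboolP vw /asboolP wu; apply/asboolP/(pres_trans vw).
Qed.

Canonical pres_equiv := EquivRel pres_rel pres_rel_refl pres_rel_sym pres_rel_trans.

Definition presented : Type := {eq_quot pres_equiv}.

HB.instance Definition _ := Choice.on presented.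

Definition word_val (w : word X) : presented := \pi_({eq_quot pres_equiv}) w.

Definition word_repr (g : presented) : word X := repr (g : {eq_quot pres_equiv}).

Lemma word_reprK g : word_val (word_repr g) = g.
Proof. exact: reprK. Qed.

Lemma word_valP v w : word_val v = word_val w <-> pres_eq R v w.
Proof.
split=> [/eqP|vw]; first by rewrite /word_val eqmodE => /asboolP.
by apply/eqP; rewrite /word_val eqmodE; apply/asboolP.
Qed.

Lemma repr_word_val w : pres_eq R (word_repr (word_val w)) w.
Proof. by apply/word_valP; rewrite word_reprK. Qed.

Definition pres_one : presented := word_val [::].
Definition pres_mul (g h : presented) : presented :=
  word_val (word_repr g ++ word_repr h).
Definition pres_inv (g : presented) : presented :=
  word_val (word_inv (word_repr g)).

Lemma word_val_cat v w :
  pres_mul (word_val v) (word_val w) = word_val (v ++ w).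
Proof. by apply/word_valP/pres_eq_cat; apply: repr_word_val. Qed.

Lemma word_val_inv w : pres_inv (word_val w) = word_val (word_inv w).
Proof. exact/word_valP/pres_eq_inv/repr_word_val. Qed.

Fact pres_mulA : associative pres_mul.
Proof.
move=> f g h; rewrite -[f]word_reprK -[g]word_reprK -[h]word_reprK.
by rewrite !word_val_cat catA.
Qed.

Fact pres_mul1g : left_id pres_one pres_mul.
Proof. by move=> g; rewrite -[g]word_reprK word_val_cat. Qed.

Fact pres_mulg1 : right_id pres_one pres_mul.
Proof. by move=> g; rewrite -[g]word_reprK word_val_cat cats0. Qed.

Fact pres_mulVg : left_inverse pres_one pres_inv pres_mul.
Proof.
move=> g; rewrite -[g]word_reprK word_val_inv word_val_cat.
exact/word_valP/pres_mulVw.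
Qed.

Fact pres_mulgV : right_inverse pres_one pres_inv pres_mul.
Proof.
move=> g; rewrite -[g]word_reprK word_val_inv word_val_cat.
exact/word_valP/pres_mulwV.
Qed.

HB.instance Definition _ := isGroup.Build presented
  pres_mulA pres_mul1g pres_mulg1 pres_mulVg pres_mulgV.

Definition pres_gen (x : X) : presented := word_val [:: (x, false)].

End PresentedGroup.

(** * Subgroups and right cosets *)

Section Subgroups.
Context (G : groupType) (H : groupClosed G).

Definition rcoset_of (g : G) : set G := [set h * g | h in [set` H]].

Definition rcosets_of : set (set G) := range rcoset_of.

Definition finite_index : Prop := finite_set rcosets_of.

Definition normal_subgroup : Prop := forall g, {in H, forall h, h ^ g \in H}.

Definition rcoset_elt (g : G) : rcosets_of := SigSub (mem_set (imageT rcoset_of g)).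

Fact rcosets_of_mulr (C : rcosets_of) (a : G) :
  [set c * a | c in val C] \in rcosets_of.
Proof.
have [g _ <-] := set_valP C; apply/mem_set; exists (g * a) => //.
apply/seteqP; split=> _ /= [h Hh <-].
- by exists (h * g); [exists h|rewrite mulgA].
- by case: Hh => k Hk <-; exists k; rewrite ?mulgA.
Qed.

Definition rcoset_mulr (C : rcosets_of) (a : G) : rcosets_of :=
  SigSub (rcosets_of_mulr C a).

End Subgroups.

(** * X-graphs *)

Record xgraph (X : Type) := XGraph {
  vertex : Type;
  edge : Type;
  label : edge -> X;
  origin : edge -> vertex;
  terminus : edge -> vertex
}.

Record xgraph_hom (X : Type) (Gamma Delta : xgraph X) := XGraphHom {
  hom_vertex : vertex Gamma -> vertex Delta;
  hom_edge : edge Gamma -> edge Delta;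
  hom_label : forall e, label (hom_edge e) = label e;
  hom_origin : forall e, origin (hom_edge e) = hom_vertex (origin e);
  hom_terminus : forall e, terminus (hom_edge e) = hom_vertex (terminus e)
}.

Record based_xgraph (X : Type) := Based {
  based_graph :> xgraph X;
  base_vertex : vertex based_graph
}.

Record based_hom (X : Type) (Gamma Delta : based_xgraph X) := BasedHom {
  based_hom_hom :> xgraph_hom Gamma Delta;
  based_hom_base : hom_vertex based_hom_hom (base_vertex Gamma) = base_vertex Delta
}.

Definition based_iso (X : Type) (Gamma Delta : based_xgraph X) : Prop :=
  exists (f : based_hom Gamma Delta) (g : based_hom Delta Gamma),
    [/\ cancel (hom_vertex f) (hom_vertex g),
        cancel (hom_vertex g) (hom_vertex f),
        cancel (hom_edge f) (hom_edge g) &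
        cancel (hom_edge g) (hom_edge f)].

(* Edges are pairs (coset, letter), so letters of X that are equal in G still give
   distinct edges. *)
Definition subgroup_graph (X : choiceType) (R : set (word X))
    (H : groupClosed (presented R)) : xgraph X :=
  {| vertex := rcosets_of H;
     edge := (rcosets_of H * X)%type;
     label := snd;
     origin := fst;
     terminus := fun e => rcoset_mulr e.1 (pres_gen R e.2) |}.

Definition subgroup_vertex (X : choiceType) (R : set (word X))
    (H : groupClosed (presented R)) : vertex (subgroup_graph H) :=
  rcoset_elt H 1.

(* Main.v *)
Require Import Defs.
From mathcomp Require Import all_boot.
From mathcomp Require Import boolp classical_sets functions cardinality.

(** A morphism of Schreier graphs preserves labels and end points, so on vertices
    it commutes with right multiplication by each generator, hence with the whole
    right action of G on the cosets of H ([hom_rcoset_mulr]).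

    If such a morphism sends the coset H to Hg, it must send the stabiliser of H,
    namely H itself, into the stabiliser of Hg, namely the conjugate of H by g.
    When all the vertices Hg are reached, this is normality ([based_hom_conj]).

    Conversely, left translation by g always commutes with the right action, and
    when H is normal it permutes the right cosets, because gHk = Hgk
    ([lcoset_rcoset]). It therefore induces an automorphism of the graph, with
    inverse the translation by the inverse of g, and it sends H to gH = Hg. *)

Set Implicit Arguments.
Unset Strict Implicit.
Unset Printing Implicit Defensive.

Local Open Scope classical_set_scope.
Local Open Scope group_scope.

Section Cosets.
Context (G : groupType) (H : groupClosed G).
Implicit Types (g k a b : G) (C : rcosets_of H).

Lemma rcoset_eltP C : exists g, C = rcoset_elt H g.
Proof. by have [g _ Cg] := set_valP C; exists g; apply: val_inj. Qed.

Lemma rcoset_elt_eq g k : rcoset_elt H g = rcoset_elt H k <-> g * k^-1 \in H.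
Proof.
split=> [/(congr1 val) /= gk|Hgk].
  have : rcoset_of H g g by exists 1; rewrite ?mul1g //=; apply: gpred1.
  by rewrite gk => -[h /= Hh <-]; rewrite mulgK.
apply/val_inj/seteqP; split=> _ /= [h Hh <-].
  by exists (h * (g * k^-1)); [apply: gpredM | rewrite -!mulgA mulVg mulg1].
exists (h * (g * k^-1)^-1); first by apply: gpredM => //; rewrite gpredV.
by rewrite -mulgA invgM invgK -mulgA mulVg mulg1.
Qed.

Lemma rcoset_elt_mulr g a :
  rcoset_mulr (rcoset_elt H g) a = rcoset_elt H (g * a).
Proof.
apply/val_inj/seteqP; split=> x /= [].
  by move=> _ [h Hh <-] <-; exists h; rewrite ?mulgA.
by move=> h Hh <-; exists (h * g); [exists h | rewrite mulgA].
Qed.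

Lemma rcoset_mulr1 C : rcoset_mulr C 1 = C.
Proof. by have [g ->] := rcoset_eltP C; rewrite rcoset_elt_mulr mulg1. Qed.

Lemma rcoset_mulrM C a b :
  rcoset_mulr C (a * b) = rcoset_mulr (rcoset_mulr C a) b.
Proof. by have [g ->] := rcoset_eltP C; rewrite !rcoset_elt_mulr mulgA. Qed.

Lemma rcoset_mulrK C a : rcoset_mulr (rcoset_mulr C a) a^-1 = C.
Proof. by rewrite -rcoset_mulrM mulgV rcoset_mulr1. Qed.

Lemma rcoset_mulrVK C a : rcoset_mulr (rcoset_mulr C a^-1) a = C.
Proof. by rewrite -rcoset_mulrM mulVg rcoset_mulr1. Qed.

End Cosets.

Section LeftTranslation.
Context (G : groupType) (H : groupClosed G) (nH : normal_subgroup H).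
Implicit Types (g k a : G) (C : rcosets_of H).

(** Normality lets g move past H: gh = h'g, where h' = h ^ g^-1 is again in H. *)
Lemma lcoset_rcoset g k :
  [set g * c | c in rcoset_of H k] = rcoset_of H (g * k).
Proof.
apply/seteqP; split=> x /= [].
  move=> _ [h Hh <-] <-; exists (h ^ g^-1); first exact: nH.
  by rewrite /conjg invgK -!mulgA mulKg.
move=> h Hh <-; exists (h ^ g * k); first by exists (h ^ g) => //; apply: nH.
by rewrite /conjg -!mulgA mulVKg.
Qed.

Fact rcosets_of_mull g C : [set g * c | c in val C] \in rcosets_of H.
Proof.
have [k ->] := rcoset_eltP C.
by rewrite lcoset_rcoset; apply/mem_set; exists (g * k).
Qed.

Definition rcoset_mull g C : rcosets_of H := SigSub (rcosets_of_mull g C).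

Lemma rcoset_elt_mull g k :
  rcoset_mull g (rcoset_elt H k) = rcoset_elt H (g * k).
Proof. exact/val_inj/lcoset_rcoset. Qed.

Lemma rcoset_mull_mulr g C a :
  rcoset_mulr (rcoset_mull g C) a = rcoset_mull g (rcoset_mulr C a).
Proof.
have [k ->] := rcoset_eltP C.
by rewrite rcoset_elt_mull !rcoset_elt_mulr rcoset_elt_mull mulgA.
Qed.

Lemma rcoset_mullK g : cancel (rcoset_mull g) (rcoset_mull g^-1).
Proof.
by move=> C; have [k ->] := rcoset_eltP C; rewrite !rcoset_elt_mull mulKg.
Qed.

Lemma rcoset_mullVK g : cancel (rcoset_mull g^-1) (rcoset_mull g).
Proof.
by move=> C; have [k ->] := rcoset_eltP C; rewrite !rcoset_elt_mull mulVKg.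
Qed.

End LeftTranslation.

Section SubgroupGraph.
Context (X : choiceType) (R : set (word X)) (H : groupClosed (presented R)).

Lemma word_val_cons x b (w : word X) :
  word_val R ((x, b) :: w) =
    (if b then (pres_gen R x)^-1 else pres_gen R x) * word_val R w.
Proof.
rewrite -cat1s -word_val_cat; case: b => //.
by congr (_ * _); rewrite [RHS]word_val_inv.
Qed.

(** An edge joins C to Cx, so its image joins the image of C to that of Cx; this
    settles the generators. For an inverse generator, the edge to use is the one
    that arrives at C. *)
Lemma hom_rcoset_mulr (f : xgraph_hom (subgroup_graph H) (subgroup_graph H))
    (C : rcosets_of H) (a : presented R) :
  hom_vertex f (rcoset_mulr C a) =
    rcoset_mulr (hom_vertex f C : rcosets_of H) a.
Proof.
have f_gen (D : rcosets_of H) x : hom_vertex f (rcoset_mulr D (pres_gen R x)) =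
    rcoset_mulr (hom_vertex f D : rcosets_of H) (pres_gen R x).
  pose e : edge (subgroup_graph H) := (D, x).
  have /= <- := hom_terminus f e; have /= -> := hom_origin f e.
  by have /= -> := hom_label f e.
rewrite -[a]word_reprK; elim: (word_repr a) C => [|[x b] w IHw] C.
  by rewrite !rcoset_mulr1.
rewrite word_val_cons !rcoset_mulrM IHw; congr rcoset_mulr.
case: b; last exact: f_gen.
by rewrite -{2}[C](rcoset_mulrVK C (pres_gen R x)) f_gen rcoset_mulrK.
Qed.

Definition mull_hom (nH : normal_subgroup H) (g : presented R) :
    xgraph_hom (subgroup_graph H) (subgroup_graph H) :=
  @XGraphHom X (subgroup_graph H) (subgroup_graph H)
    (rcoset_mull nH g) (fun e => (rcoset_mull nH g e.1, e.2))
    (fun=> erefl) (fun=> erefl)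
    (fun e => rcoset_mull_mulr nH g e.1 (pres_gen R e.2)).

Lemma normal_based_iso (nH : normal_subgroup H) (g : presented R) :
  based_iso (Based (subgroup_vertex H))
    (@Based X (subgroup_graph H) (rcoset_elt H g)).
Proof.
have f_base : hom_vertex (mull_hom nH g) (subgroup_vertex H) = rcoset_elt H g.
  by rewrite [LHS]rcoset_elt_mull mulg1.
have g_base :
    hom_vertex (mull_hom nH g^-1) (rcoset_elt H g) = subgroup_vertex H.
  by rewrite [LHS]rcoset_elt_mull mulVg.
exists (@BasedHom X (Based (subgroup_vertex H))
  (@Based X (subgroup_graph H) (rcoset_elt H g)) _ f_base).
exists (@BasedHom X (@Based X (subgroup_graph H) (rcoset_elt H g))
  (Based (subgroup_vertex H)) _ g_base).
split=> /=.
- exact: rcoset_mullK.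
- exact: rcoset_mullVK.
- by case=> C x /=; rewrite rcoset_mullK.
- by case=> C x /=; rewrite rcoset_mullVK.
Qed.

(** The image of the base vertex inherits its stabiliser: H = Hh gives
    Hg = Hgh. *)
Lemma based_hom_conj (g h : presented R) :
  based_hom (Based (subgroup_vertex H))
    (@Based X (subgroup_graph H) (rcoset_elt H g)) ->
  h \in H -> h ^ g^-1 \in H.
Proof.
case=> f /= f_base Hh.
have Hh_fix : rcoset_mulr (rcoset_elt H 1) h = rcoset_elt H 1.
  by rewrite rcoset_elt_mulr mul1g; apply/rcoset_elt_eq; rewrite invg1 mulg1.
have := hom_rcoset_mulr f (rcoset_elt H 1) h.
rewrite Hh_fix [hom_vertex f _]f_base rcoset_elt_mulr => /esym /rcoset_elt_eq.
by rewrite /conjg invgK mulgA.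
Qed.

End SubgroupGraph.

Theorem theorem4p14 (X : finType) (R : set (word X))
    (H : groupClosed (presented R)) :
  finite_index H ->
  (normal_subgroup H <->
   forall v : vertex (subgroup_graph H),
     based_iso (Based (subgroup_vertex H)) (Based v)).
Proof.
move=> _; split=> [nH v|iso_all g h Hh].
  by have [g ->] := rcoset_eltP (v : rcosets_of H); apply: normal_based_iso.
have [f _] := iso_all (rcoset_elt H g^-1).
by rewrite -[g]invgK; apply: based_hom_conj f Hh.
Qed.
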